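(* Let $p\neq3,7$ be an odd prime, and let $\{u_n\}_{n\geq0}$ be the Lucas sequence defined by $u_0=0$, $u_1=1$, $u_{n+1}=4u_n-7u_{n-1}$ for $n\geq1$. If $p\equiv1\pmod3$, then $$\frac{u_{p-1}}p\equiv\frac16\sum_{k=1}^{\frac{p-1}{6}}\frac{64^k}{k}+\frac13q_p(7)+\frac12q_p(3)\equiv-\frac{1}{3}\sum_{k=1}^{\frac{p-1}{6}}\frac{64^k}{6k-1}-\frac{1}{18}q_p(7)+\frac16q_p(3)\pmod p.$$ If $p\equiv2\pmod3$, then $$\frac{u_{p+1}}p\equiv-\frac76\sum_{k=1}^{\frac{p-5}{6}}\frac{64^k}{k}-\frac73q_p(7)-\frac72q_p(3)\equiv\frac{7}{6}\sum_{k=1}^{\frac{p+1}{6}}\frac{64^k}{6k-2}+\frac{7}{18}q_p(7)+\frac76q_p(3)\pmod p.$$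
   Context: For an odd prime $p$ and an integer $b$ with $p\nmid b$, $q_p(b)=(b^{p-1}-1)/p$ is the Fermat quotient. Congruences modulo $p$ are between rational numbers with denominators prime to $p$: $x\equiv y\pmod p$ means that $x-y=pz$ with $z$ rational whose denominator is prime to $p$. Empty sums are $0$. *)

(* Defs.v *)
From mathcomp Require Import all_boot all_order all_algebra.
Set Implicit Arguments.
Unset Strict Implicit.
Unset Printing Implicit Defensive.
Import Order.TTheory GRing.Theory Num.Theory.
Local Open Scope ring_scope.

(* [denq] is the positive denominator in lowest terms, so for p prime this
   says that the denominator of x is prime to p. *)
Definition p_integral (p : nat) (x : rat) : bool := coprimez p%:Z (denq x).

(* The congruence relates p-integral rationals only; both sides are required
   to be p-integral. *)
Definition eqmodq (p : nat) (x y : rat) : Prop :=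
  [/\ p_integral p x, p_integral p y &
      exists2 z : rat, p_integral p z & x - y = p%:R * z].

(* An integer whenever p is prime and does not divide b. *)
Definition fermat_quotient (p : nat) (b : int) : rat :=
  (b%:~R ^+ (p - 1) - 1) / p%:R.

(* Main.v *)
Require Import Defs.
From mathcomp Require Import all_boot all_order all_algebra all_field.
From mathcomp Require Import ring lra zify.
Set Implicit Arguments.
Unset Strict Implicit.
Unset Printing Implicit Defensive.
Import Order.TTheory GRing.Theory Num.Theory.
Local Open Scope ring_scope.

(** Let z be a primitive sixth root of unity, so z^2 = z - 1.  As zeta runs
over the six powers of z, the number 1 - 2 zeta takes the values -1, 3,
sqrt(-3), - sqrt(-3), 1 + 2z and 3 - 2z, and the last two are the roots of
x^2 - 4x + 7, the characteristic polynomial of u.  Hence for a residue s mod 6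
the sum

  sum_zeta zeta^s (1 - 2 zeta)^p = 6 sum_(6 | j + s) C(p, j) (-2)^j

can be computed twice.  The left side is an explicit combination of 3^p,
(-3)^((p-1)/2), u_p and u_(p+1) ([residue_sum_lucas]).  On the right side,
C(p, j) (-2)^j = - p 2^j / j modulo p^2 for 0 < j < p
([bin_prime_expansion]), so modulo p^2 only the sum L_s of 2^j / j over j = -s
mod 6 remains ([residue_sum_expansion]).  Writing j = 6k - s turns L_0, L_1 and
L_2 into the sums of 64^k / k, 64^k / (6k - 1) and 64^k / (6k - 2) of the
theorem ([power_sumE]).

Three residues s suffice for each of p = 1 and p = 5 mod 6.  Modulo p they
already determine u_p, u_(p+1) and (-3)^((p-1)/2): in the first case these are
1, 4, 1, and p divides u_(p-1); in the second case they are -1, 0, -1.  So each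
differs from its value modulo p by p times a p-integral number.  The remaining
relations are the norm equation u_(p+1)^2 - 4 u_p u_(p+1) + 7 u_p^2 = 7^p and
((-3)^((p-1)/2))^2 = 3^(p-1); to first order in p they express the corrections
through q_p(7) and q_p(3), and the two congruences for the Lucas quotient come
from two of the residues s ([eliminate_mod6_1], [eliminate_mod6_5]). *)

(** * Rational numbers with denominator prime to p *)

(** Any denominator prime to p will do: the reduced one divides it. *)
Lemma p_integral_intro (p : nat) (x : rat) (a b : int) :
  coprimez p%:Z b -> x * b%:~R = a%:~R -> p_integral p x.
Proof.
move=> pb; rewrite -{1}[x]divq_num_den => /(congr1 ( *%R^~ (denq x)%:~R)).
rewrite mulrAC divfK ?intq_eq0 ?denq_neq0 // -!intrM => /intr_inj eq_ab.
apply: coprimez_dvdr pb.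
have : (denq x %| numq x * b)%Z by rewrite eq_ab dvdz_mull.
by rewrite Gauss_dvdzr // coprimez_sym coprimezE coprime_num_den.
Qed.

Lemma p_integral_elim (p : nat) (x : rat) :
  p_integral p x -> exists a b : int,
    coprimez p%:Z b /\ x * b%:~R = a%:~R.
Proof.
move=> px; exists (numq x), (denq x); split=> //.
by rewrite -{1}[x]divq_num_den divfK ?intq_eq0 ?denq_neq0.
Qed.

Lemma p_integral_int (p : nat) (a : int) : p_integral p a%:~R.
Proof. by apply: (@p_integral_intro _ _ a 1); rewrite ?mulr1 // /coprimez gcdz1. Qed.

Lemma p_integral_nat (p n : nat) : p_integral p n%:R.
Proof. exact: (p_integral_int p n). Qed.

Lemma p_integralN (p : nat) (x : rat) : p_integral p x -> p_integral p (- x).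
Proof. by rewrite /p_integral denqN. Qed.

Lemma p_integralM (p : nat) (x y : rat) :
  p_integral p x -> p_integral p y -> p_integral p (x * y).
Proof.
move=> /p_integral_elim[a [b [pb xb]]] /p_integral_elim[c [d [pd yd]]].
apply: (@p_integral_intro _ _ (a * c) (b * d)); first by rewrite coprimezMr pb.
by rewrite !intrM mulrACA xb yd.
Qed.

Lemma p_integralD (p : nat) (x y : rat) :
  p_integral p x -> p_integral p y -> p_integral p (x + y).
Proof.
move=> /p_integral_elim[a [b [pb xb]]] /p_integral_elim[c [d [pd yd]]].
apply: (@p_integral_intro _ _ (a * d + c * b) (b * d)).
  by rewrite coprimezMr pb.
by rewrite intrD !intrM -xb -yd; ring.
Qed.

Lemma p_integralX (p n : nat) (x : rat) : p_integral p x -> p_integral p (x ^+ n).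
Proof.
move=> px; elim: n => [|n IHn]; first exact: p_integral_nat 1%N.
by rewrite exprS p_integralM.
Qed.

Lemma p_integral_sum (p : nat) (I : Type) (r : seq I) (P : pred I) (F : I -> rat) :
  (forall i, P i -> p_integral p (F i)) -> p_integral p (\sum_(i <- r | P i) F i).
Proof.
move=> pF; apply: (big_ind (fun x => p_integral p x)) => //.
  exact: p_integral_nat 0%N.
exact: p_integralD.
Qed.

Lemma p_integralV (p n : nat) : coprime p n -> p_integral p n%:R^-1.
Proof.
have [->|n_gt0] := posnP n; first by rewrite invr0 => _; exact: p_integral_nat 0%N.
move=> pn; apply: (@p_integral_intro _ _ 1 n); first by rewrite coprimezE.
by rewrite mulVf ?pnatr_eq0 -?lt0n.
Qed.

(** Matching on the syntax keeps unification from computing in the rationals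
when it compares a compound expression with a cast. *)
Ltac p_integral_tac :=
  lazymatch goal with
  | |- is_true (p_integral _ (_ + _)) =>
      apply: p_integralD; p_integral_tac
  | |- is_true (p_integral _ (- _)) => apply: p_integralN; p_integral_tac
  | |- is_true (p_integral _ (_ * _)) =>
      apply: p_integralM; p_integral_tac
  | |- is_true (p_integral _ (_ ^+ _)) => apply: p_integralX; p_integral_tac
  | |- is_true (p_integral _ _^-1) => apply: p_integralV; assumption
  | |- is_true (p_integral _ 1) => exact: (p_integral_nat _ 1)
  | |- is_true (p_integral _ _%:R) => exact: p_integral_nat
  | |- is_true (p_integral _ _%:~R) => exact: p_integral_int
  | |- _ => assumption
  end.

(** p-integrality of the left side follows from that of the other data. *)
Lemma eqmodq_intro (p : nat) (x y z : rat) :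
  p_integral p y -> p_integral p z -> x - y = p%:R * z -> eqmodq p x y.
Proof.
move=> py pz xy; split=> //; last by exists z.
by rewrite -[x](subrK y) xy; p_integral_tac.
Qed.

Lemma eqmodq_sym (p : nat) (x y : rat) : eqmodq p x y -> eqmodq p y x.
Proof.
case=> px py [z pz xy]; split=> //; exists (- z); first exact: p_integralN.
by rewrite mulrN -xy opprB.
Qed.

Lemma eqmodq_trans (p : nat) (x y w : rat) :
  eqmodq p x y -> eqmodq p y w -> eqmodq p x w.
Proof.
case=> px _ [z pz xy] [_ pw [t pt yw]]; split=> //.
by exists (z + t); [exact: p_integralD | rewrite mulrDr -xy -yw addrA subrK].
Qed.

Lemma fermat_quotientE (p : nat) (b : int) : prime p ->
  b%:~R ^+ p = b%:~R * (1 + p%:R * fermat_quotient p b) :> rat.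
Proof.
move=> p_pr; have p0 : p%:R != 0 :> rat by rewrite pnatr_eq0 -lt0n prime_gt0.
rewrite /fermat_quotient [p%:R * _]mulrC divfK // subn1 addrC subrK -exprS.
by rewrite prednK ?prime_gt0.
Qed.

Lemma p_integral_fermat_quotient (p b : nat) :
  prime p -> coprime p b -> p_integral p (fermat_quotient p b).
Proof.
move=> p_pr pb; have p0 : p%:R != 0 :> rat by rewrite pnatr_eq0 -lt0n prime_gt0.
have b_gt0 : (0 < b ^ (p - 1))%N.
  rewrite expn_gt0; have [b0|//] := posnP b; move: pb p_pr.
  by rewrite b0 /coprime gcdn0 => /eqP ->.
have /dvdnP[k bp] : (p %| b ^ (p - 1) - 1)%N.
  have := @cyclic.Euler_exp_totient b p; rewrite coprime_sym => /(_ pb) /eqP.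
  by rewrite totient_prime // -subn1 eqn_mod_dvd.
suff -> : fermat_quotient p b = k%:R by exact: p_integral_nat.
apply: (mulIf p0); rewrite /fermat_quotient divfK // -natrM -bp natrB //.
by rewrite natrX.
Qed.

(** * Binomial coefficients modulo p^2 *)

(** Pascal's rule, since p divides C(p, k) for 0 < k < p. *)
Lemma bin_pred_prime (p k : nat) : prime p -> (k < p)%N ->
  (p%:Z %| 'C(p.-1, k)%:Z - (-1) ^+ k)%Z.
Proof.
move=> p_pr; elim: k => [|k IHk] k_lt; first by rewrite bin0 subrr dvdz0.
have -> : 'C(p.-1, k.+1)%:Z - (-1) ^+ k.+1 =
    'C(p, k.+1)%:Z - ('C(p.-1, k)%:Z - (-1) ^+ k).
  by rewrite -{2}(prednK (prime_gt0 p_pr)) binS PoszD exprS; ring.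
by rewrite rpredB ?IHk ?(ltnW k_lt) //= dvdzE prime_dvd_bin.
Qed.

(** From j C(p, j) = p C(p - 1, j - 1) and C(p - 1, j - 1) = (-1)^(j - 1)
modulo p. *)
Lemma bin_prime_expansion (p j : nat) (x : int) :
  prime p -> (0 < j < p)%N ->
  exists2 z, p_integral p z &
    'C(p, j)%:R * (- x%:~R) ^+ j = p%:R * (- (x%:~R ^+ j / j%:R) + p%:R * z) :> rat.
Proof.
move=> p_pr /andP[j_gt0 j_lt].
have [k Ck] : exists k : int, 'C(p.-1, j.-1)%:Z = (-1) ^+ j.-1 + k * p%:Z.
  have j1 : (j.-1 < p)%N by lia.
  have /dvdzP[k Ek] := bin_pred_prime p_pr j1.
  by exists k; rewrite -Ek; ring.
have pj : coprime p j by rewrite prime_coprime // gtnNdvd.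
have j0 : j%:R != 0 :> rat by rewrite pnatr_eq0 -lt0n.
exists (k%:~R * (- x%:~R) ^+ j * j%:R^-1); first by p_integral_tac.
apply: (mulIf j0).
have := mul_bin_diag p j.-1; rewrite prednK // => /(congr1 (fun n => n%:R : rat)).
rewrite !natrM mulrAC [_ * j%:R]mulrC => <-.
have -> : 'C(p.-1, j.-1)%:R = (-1) ^+ j.-1 + k%:~R * p%:R :> rat.
  by rewrite -[LHS]/((Posz 'C(p.-1, j.-1))%:~R) Ck intrD intrM rmorphXn.
have -> : x%:~R ^+ j = - (-1) ^+ j.-1 * (- x%:~R) ^+ j :> rat.
  rewrite [(- _) ^+ j]exprNn; case: (j) j_gt0 => // i _; rewrite (exprS (-1) i).
  by rewrite mulN1r mulrA mulrNN -expr2 sqrr_sign mul1r.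
by field.
Qed.

(** * Binomial sums over a residue class modulo 6 *)

Section SixthRoots.
Variables (R : comNzRingType) (z : R).
Hypothesis z2 : z ^+ 2 = z - 1.

Lemma sixth_root_exp6 : z ^+ 6 = 1.
Proof. rewrite (exprM z 2 3) z2; ring: z2. Qed.

Lemma sum_sixth_root_powers (m : nat) :
  \sum_(i < 6) (z ^+ i) ^+ m = 6 * (6 %| m)%N%:R.
Proof.
have -> : \sum_(i < 6) (z ^+ i) ^+ m = \sum_(i < 6) (z ^+ (m %% 6)) ^+ i.
  apply: eq_bigr => i _; rewrite -!exprM mulnC {1}(divn_eq m 6) mulnDl exprD.
  by rewrite mulnAC mulnC exprM sixth_root_exp6 expr1n mul1r.
rewrite /dvdn; have := ltn_pmod m (isT : 0 < 6)%N.
rewrite !big_ord_recl big_ord0 /= /bump /=.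
by case: (m %% 6)%N => [|[|[|[|[|[|]]]]]] //= _; ring: z2.
Qed.

(** Expanding by the binomial theorem, each j is weighted by the sum of the
powers of exponent j + s of the sixth roots of unity. *)
Lemma sixth_root_filter (n s : nat) :
  \sum_(i < 6) (z ^+ i) ^+ s * (1 - 2 * z ^+ i) ^+ n =
  6 * \sum_(j < n.+1 | (6 %| j + s)%N) 'C(n, j)%:R * (- 2) ^+ j.
Proof.
rewrite mulr_sumr [RHS]big_mkcond /=.
under eq_bigr => i _ do rewrite exprDn mulr_sumr.
rewrite exchange_big /=; apply: eq_bigr => j _ /=.
rewrite (eq_bigr (fun i : 'I_6 => 'C(n, j)%:R * (- 2) ^+ j * (z ^+ i) ^+ (j + s))).
  by rewrite -mulr_sumr sum_sixth_root_powers; case: ifP => _ /=; ring.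
by move=> i _; rewrite expr1n mul1r -mulNr exprMn exprD -mulr_natl; ring.
Qed.

End SixthRoots.

Definition residue_sum (n s : nat) : int :=
  \sum_(j < n.+1 | (6 %| j + s)%N) 'C(n, j)%:R * (- 2) ^+ j.

Section Lucas.
Variable u : nat -> int.
Hypotheses (u0 : u 0%N = 0) (u1 : u 1%N = 1).
Hypothesis uS : forall n : nat, (1 <= n)%N ->
  u (n + 1)%N = 4 * u n - 7 * u (n - 1)%N.

Lemma lucas_rec (n : nat) : u n.+2 = 4 * u n.+1 - 7 * u n.
Proof. by have := uS (ltn0Sn n); rewrite addn1 subn1. Qed.

Lemma lucas_root_exp (R : comNzRingType) (a b : R) (n : nat) :
  a + b = 4 -> a * b = 7 -> a ^+ n = (u n.+1)%:~R - (u n)%:~R * b.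
Proof.
move=> ab4 ab7; have aE : a = 4 - b by rewrite -ab4 addrK.
have b2 : b ^+ 2 = 4 * b - 7 by rewrite -ab7 aE; ring.
elim: n => [|n IHn]; first by rewrite u0 u1; ring.
by rewrite exprS IHn lucas_rec aE; ring: aE b2.
Qed.

(** The norm of a root of x^2 - 4x + 7, raised to the power n. *)
Lemma lucas_norm (n : nat) :
  u n.+1 ^+ 2 - 4 * u n.+1 * u n + 7 * u n ^+ 2 = 7 ^+ n.
Proof.
elim: n => [|n IHn]; first by rewrite u0 u1; ring.
by rewrite (exprS 7 n) -IHn lucas_rec; ring.
Qed.

(** The sixth root filter evaluated in the algebraic numbers, where
(1 - 2z)^2 = -3 and where 1 + 2z and 3 - 2z = 1 - 2 (z - 1) are the roots of
x^2 - 4x + 7.  The exponent is odd so that the powers of the two square roots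
of -3 are opposite. *)
Lemma residue_sum_lucas (m : nat) (n := m.*2.+1) (e := (- 3) ^+ m : int) :
  [/\ 6 * residue_sum n 0 = - 1 + 3 ^+ n + 2 * u n.+1 - 4 * u n,
      6 * residue_sum n 1 = - 1 - 3 ^+ n + 3 * e + 5 * u n - u n.+1,
      6 * residue_sum n 2 = - 1 + 3 ^+ n + 3 * e - u n - u n.+1,
      6 * residue_sum n 4 = - 1 + 3 ^+ n - 3 * e + 5 * u n - u n.+1 &
      6 * residue_sum n 5 = - 1 - 3 ^+ n - 3 * e - u n - u n.+1].
Proof.
have [z z2] : exists z : algC, z ^+ 2 = z - 1.
  exists ((1 + 'i * sqrtC 3) / 2).
  by field: (sqrCi algC) (sqrtCK (3 : algC)).
have sqrtE : (1 - 2 * z) ^+ 2 = (- 3)%:~R :> algC by ring: z2.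
have powE : [/\ (1 - 2 * z) ^+ n = e%:~R * (1 - 2 * z),
    (1 - 2 * (z - 1)) ^+ n = (u n.+1)%:~R - (u n)%:~R * (1 + 2 * z),
    (1 + 2 * z) ^+ n = (u n.+1)%:~R - (u n)%:~R * (1 - 2 * (z - 1)) &
    (1 - 2 * (1 - z)) ^+ n = - (e%:~R * (1 - 2 * z))].
  split; [|apply: lucas_root_exp; ring: z2|apply: lucas_root_exp; ring: z2|].
    by rewrite /n exprS -mul2n exprM sqrtE -rmorphXn mulrC.
  have -> : 1 - 2 * (1 - z) = - (1 - 2 * z) by ring.
  by rewrite /n exprS -mul2n exprM sqrrN sqrtE -rmorphXn mulNr mulrC.
(* The six terms are those of the powers 1, z, z - 1, -1, -z, 1 - z of z. *)
have evalE s : (6 * residue_sum n s)%:~R =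
    - 1 + z ^+ s * (e%:~R * (1 - 2 * z))
    + (z - 1) ^+ s * ((u n.+1)%:~R - (u n)%:~R * (1 + 2 * z))
    + (- 1) ^+ s * (3 ^+ n : int)%:~R
    + (- z) ^+ s * ((u n.+1)%:~R - (u n)%:~R * (1 - 2 * (z - 1)))
    - (1 - z) ^+ s * (e%:~R * (1 - 2 * z)) :> algC.
  rewrite rmorphM rmorph_sum /=.
  under eq_bigr => j _ do rewrite rmorphM /= rmorphXn rmorphN /= !rmorph_nat.
  have [powE1 powE2 powE4 powE5] := powE.
  have z3 : z ^+ 3 = - 1 by ring: z2.
  have z4 : z ^+ 4 = - z by ring: z2.
  have z5 : z ^+ 5 = 1 - z by ring: z2.
  rewrite -(sixth_root_filter z2) !big_ord_recl big_ord0 /= /bump /= !addn0.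
  rewrite expr0 expr1 z2 z3 z4 z5 powE1 powE2 powE5 !mulrN !opprK powE4.
  rewrite mulr1 expr1n mul1r -[n in (1 - 2) ^+ n]/(m.*2.+1).
  have [-> ->] : (1 - 2 = - 1 :> algC) * (1 + 2 = 3 :> algC) by split; ring.
  rewrite (_ : (3 ^+ n : int)%:~R = 3 ^+ n); last by rewrite rmorphXn.
  by rewrite exprS -mul2n exprM sqrrN !expr1n mulr1 addr0 !addrA.
clearbody e; move: (3 ^+ n) evalE => t evalE.
by split; apply: (@intr_inj algC); rewrite evalE; ring: z2.
Qed.

End Lucas.

Lemma sum_ord_split_ends (V : nmodType) (Q : pred nat) (F : nat -> V) (n : nat) :
    (0 < n)%N -> ~~ Q n ->
  \sum_(j < n.+1 | Q j) F j =
  (if Q 0%N then F 0%N else 0) + \sum_(1 <= j < n | Q j) F j.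
Proof.
move=> n_gt0 Qn; rewrite big_mkcond.
rewrite -(big_mkord xpredT (fun j => if Q j then F j else 0)).
by rewrite big_nat_recr //= big_ltn //= (negbTE Qn) addr0 -big_mkcond.
Qed.

(** The term j = 0 contributes the 1 when 6 divides s, the hypothesis on p + s
removes the term j = p, and the other binomials are divisible by p. *)
Lemma residue_sum_expansion (p s : nat) : prime p -> ~~ (6 %| p + s)%N ->
  exists2 w, p_integral p w &
    (residue_sum p s)%:~R = (6 %| s)%N%:R
      - p%:R * (\sum_(1 <= j < p | (6 %| j + s)%N) 2 ^+ j / j%:R)
      + p%:R ^+ 2 * w :> rat.
Proof.
move=> p_pr ps.
(* A single choice of the remainders for all j, so that they can be summed. *)
have [w [pw wE]] : exists w : nat -> rat, (forall j, p_integral p (w j)) /\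
    forall j, (0 < j < p)%N -> 'C(p, j)%:R * (- 2) ^+ j =
       p%:R * (- (2 ^+ j / j%:R) + p%:R * w j).
  have /fin_all_exists[w w_] (j : 'I_p) : exists w : rat, p_integral p w /\
      ((0 < j)%N -> 'C(p, j)%:R * (- 2) ^+ j =
         p%:R * (- (2 ^+ j / j%:R) + p%:R * w)).
    case: (posnP j) => [_|j_gt0]; first by exists 0; split; [exact: p_integral_nat 0%N|].
    have [|w pw E] := @bin_prime_expansion p j 2 p_pr; first by rewrite j_gt0 /=.
    by exists w.
  exists (fun j => if insub j is Some i then w i else 0); split=> [j|j /andP[j_gt0 j_lt]].
    case: insubP => [i _ _|_]; [by case: (w_ i) | exact: p_integral_nat 0%N].
  by rewrite insubT; apply: (proj2 (w_ (Ordinal j_lt))).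
exists (\sum_(1 <= j < p | (6 %| j + s)%N) w j); first exact: p_integral_sum.
rewrite /residue_sum rmorph_sum /=.
rewrite (@sum_ord_split_ends _ (fun j => 6 %| j + s)%N
  (fun j => ('C(p, j)%:R * (-2) ^+ j : int)%:~R)) ?prime_gt0 //.
rewrite add0n bin0 expr0 mulr1.
have -> : \sum_(1 <= j < p | (6 %| j + s)%N) ('C(p, j)%:R * (-2) ^+ j : int)%:~R =
   \sum_(1 <= j < p | (6 %| j + s)%N) p%:R * (- (2 ^+ j / j%:R) + p%:R * w j) :> rat.
  rewrite big_nat_cond [RHS]big_nat_cond; apply: eq_bigr => j /andP[j_range _].
  by rewrite -wE // rmorphM /= rmorph_nat rmorphXn rmorphN /= rmorph_nat.
rewrite -mulr_sumr big_split /= sumrN -mulr_sumr.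
by case: ifP => _ /=; ring.
Qed.

(** * Sums of 2^j / j over a residue class modulo 6 *)

(** The bounds on n say that 6m - s is the last index below n that is
congruent to -s modulo 6. *)
Lemma sum_residue6 (V : nmodType) (F : nat -> V) (m s n : nat) :
    (s < 6)%N -> (6 * m - s < n <= 6 * m.+1 - s)%N ->
  \sum_(1 <= j < n | (6 %| j + s)%N) F j =
  \sum_(1 <= k < m.+1) F (6 * k - s)%N.
Proof.
move=> s_lt /andP[lt_n le_n].
elim: m n lt_n le_n => [|m IHm] n lt_n le_n.
  rewrite [RHS]big_geq // big_nat_cond big1 // => j.
  move=> /andP[/andP[j_gt0 j_lt] j6]; exfalso; lia.
have n0_le : (6 * m.+1 - s <= n)%N by lia.
rewrite (big_cat_nat (n := (6 * m.+1 - s)%N)) ?IHm //=; try lia.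
rewrite [RHS]big_nat_recr //=; congr (_ + _).
(* Among the indices from 6(m+1) - s on, only the first one is selected. *)
rewrite big_ltn_cond // ifT; last by lia.
rewrite big_nat_cond big1 ?addr0 // => j.
by move=> /andP[/andP[j_gt j_lt] j6]; exfalso; lia.
Qed.

Definition power_sum (p s : nat) : rat :=
  \sum_(1 <= j < p | (6 %| j + s)%N) 2 ^+ j / j%:R.

Lemma p_integral_power_sum (p s : nat) : prime p -> p_integral p (power_sum p s).
Proof.
move=> p_pr; rewrite /power_sum big_nat_cond; apply: p_integral_sum => j.
move=> /andP[/andP[j_gt0 j_lt] _].
have pj : coprime p j by rewrite prime_coprime // gtnNdvd.
by p_integral_tac.
Qed.

Lemma power_sumE (p m s : nat) : (s < 6)%N ->
    (6 * m - s < p <= 6 * m.+1 - s)%N ->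
  \sum_(1 <= k < m.+1) 64 ^+ k / (6 * k%:R - s%:R) = 2 ^+ s * power_sum p s.
Proof.
move=> s_lt p_range; rewrite /power_sum (sum_residue6 _ s_lt p_range) mulr_sumr.
apply: eq_big_nat => k /andP[k_gt0 k_lt].
have s_le : (s <= 6 * k)%N by lia.
rewrite natrB // natrM mulrA -exprD subnKC // exprM.
by congr (_ ^+ k / _); ring.
Qed.

Lemma sum_inverses_multiples6 (p m : nat) : (6 * m < p <= 6 * m.+1)%N ->
  \sum_(1 <= k < m.+1) 64 ^+ k / k%:R = 6 * power_sum p 0.
Proof.
move=> p_range; have := @power_sumE p m 0; rewrite !subn0 expr0 mul1r => <- //.
rewrite mulr_sumr; apply: eq_big_nat => k /andP[k_gt0 _].
by field; rewrite pnatr_eq0 -lt0n.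
Qed.

(** * Solving the congruences *)

(** In both lemmas P stands for p, a and b for the Fermat quotients of 3 and 7,
X and Y for u_p and u_(p+1), e for (-3)^((p-1)/2).  The three linear equations
are solved for U or Y, X and e; c, x and f are the corrections divided by P, as
explicit combinations of p-integral numbers so that p-integrality can be read
off. *)
Section Elimination.
Variables (F : realFieldType) (P a b e X L0 w0 : F).

(** Working with U = u_(p-1) instead of Y brings the coefficient 14 of c in
k_eq and, through the norm equation, the relation 2x - 4c = b modulo P; using
this and 2f = a modulo P to remove x and f from k_eq and f_eq, each of these
expresses c. *)
Lemma eliminate_mod6_1 (U L1 L4 w1 w4 : F) (Y := 4 * X - 7 * U)
    (k0 := - L0 + P * w0) (k1 := - L1 - L4 + P * (w1 + w4))
    (c := (4 * k1 + a - 2 * k0) / 14) (x := 3 * k1 - 7 * c)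
    (f := (3 * a - x - 7 * c - 6 * L1 + 6 * P * w1) / 3) :
  P != 0 ->
  2 + 3 * P * a + 2 * Y - 4 * X = 6 * (1 - P * L0 + P ^+ 2 * w0) ->
  - 4 - 3 * P * a + 3 * e + 5 * X - Y = 6 * (0 - P * L1 + P ^+ 2 * w1) ->
  2 + 3 * P * a - 3 * e + 5 * X - Y = 6 * (0 - P * L4 + P ^+ 2 * w4) ->
  Y ^+ 2 - 4 * Y * X + 7 * X ^+ 2 = 7 * (1 + P * b) ->
  e ^+ 2 = 1 + P * a ->
  [/\ U = P * c,
      c - (L0 + 1 / 3 * b + 1 / 2 * a) =
        P * (- (6 * w0 + 2 * x ^+ 2 - 8 * c * x + 14 * c ^+ 2) / 6) &
      c - (- (2 / 3) * L1 - 1 / 18 * b + 1 / 6 * a) =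
        P * ((6 * w1 + x ^+ 2 / 2 - 2 * c * x + 7 * c ^+ 2 / 2
              + 3 * f ^+ 2 / 2) / 9)].
Proof.
move=> P0 E0 E1 E4 norm_XY sqr_e.
have k_eq : 3 * a + 4 * x - 14 * c = - 6 * L0 + 6 * P * w0.
  by rewrite /x /c /k1 /k0; field.
have f_eq : - 3 * a + 3 * f + x + 7 * c = - 6 * L1 + 6 * P * w1.
  by rewrite /f; field.
have UE : U = P * c.
  by move: E0 E1 E4; rewrite /Y /c /k1 /k0; lra.
have XE : X = 1 + P * x.
  by move: E0 E1 E4; rewrite /x /Y /c /k1 /k0; lra.
have eE : e = 1 + P * f.
  by move: E1 UE XE; rewrite /f /Y; lra.
move: norm_XY; rewrite /Y XE UE.
move: sqr_e; rewrite eE.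
move: k_eq f_eq; clearbody c x f; clear -P0 => k_eq f_eq sqr_e norm_XY.
have norm_c : 2 * x + P * x ^+ 2 - 4 * c * (1 + P * x) + 7 * P * c ^+ 2 = b.
  by apply: (mulfI P0); lra.
have sqr_f : 2 * f + P * f ^+ 2 = a by apply: (mulfI P0); lra.
by split=> //; lra.
Qed.

(** Here P divides Y itself; the norm equation gives 4c - 14x = 7b and the last
relation -2f = a, both modulo P. *)
Lemma eliminate_mod6_5 (Y L2 L5 w2 w5 : F)
    (k0 := - L0 + P * w0) (k2 := - L2 - L5 + P * (w2 + w5))
    (c := k0 - 2 * k2 - a / 2) (x := - c - 3 * k2)
    (f := (- 6 * L2 + 6 * P * w2 - 3 * a + x + c) / 3)
    (r := c ^+ 2 - 4 * x * c + 7 * x ^+ 2) :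
  P != 0 ->
  2 + 3 * P * a + 2 * Y - 4 * X = 6 * (1 - P * L0 + P ^+ 2 * w0) ->
  2 + 3 * P * a + 3 * e - X - Y = 6 * (0 - P * L2 + P ^+ 2 * w2) ->
  - 4 - 3 * P * a - 3 * e - X - Y = 6 * (0 - P * L5 + P ^+ 2 * w5) ->
  Y ^+ 2 - 4 * Y * X + 7 * X ^+ 2 = 7 * (1 + P * b) ->
  e ^+ 2 = 1 + P * a ->
  [/\ Y = P * c,
      c - (- 7 * L0 - 7 / 3 * b - 7 / 2 * a) = P * (7 * w0 + r / 3) &
      c - (14 / 3 * L2 + 7 / 18 * b + 7 / 6 * a) =
        P * (7 * (3 * f ^+ 2 / 2 - r / 14 - 6 * w2) / 9)].
Proof.
move=> P0 E0 E2 E5 norm_XY sqr_e.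
have k_eq : 3 * a + 2 * c - 4 * x = - 6 * L0 + 6 * P * w0.
  by rewrite /x /c /k2 /k0; field.
have f_eq : 3 * a + 3 * f - x - c = - 6 * L2 + 6 * P * w2 by rewrite /f; field.
have YE : Y = P * c by move: E0 E2 E5; rewrite /c /k2 /k0; lra.
have XE : X = - 1 + P * x.
  by move: E0 E2 E5; rewrite /x /c /k2 /k0; lra.
have eE : e = - 1 + P * f by move: E2 YE XE; rewrite /f; lra.
move: norm_XY; rewrite XE YE.
move: sqr_e; rewrite eE /r.
move: k_eq f_eq; clearbody c x f; clear -P0 => k_eq f_eq sqr_e norm_XY.
have norm_c : P * c ^+ 2 + 4 * c - 4 * P * x * c - 14 * x + 7 * P * x ^+ 2 = 7 * b.
  by apply: (mulfI P0); lra.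
have sqr_f : - 2 * f + P * f ^+ 2 = a by apply: (mulfI P0); lra.
by split=> //; lra.
Qed.

End Elimination.

Section Congruences.
Variables (p : nat) (u : nat -> int).
Hypotheses (p_pr : prime p) (p_odd : odd p) (p_neq3 : p <> 3%N) (p_neq7 : p <> 7%N).
Hypotheses (u0 : u 0%N = 0) (u1 : u 1%N = 1).
Hypothesis uS : forall n : nat, (1 <= n)%N ->
  u (n + 1)%N = 4 * u n - 7 * u (n - 1)%N.

Let P : rat := p%:R.
Let X : rat := (u p)%:~R.
Let Y : rat := (u p.+1)%:~R.
Let e : rat := ((- 3) ^+ p./2)%:~R.
Let q3 := fermat_quotient p 3.
Let q7 := fermat_quotient p 7.

Let P0 : P != 0. Proof. by rewrite pnatr_eq0 -lt0n prime_gt0. Qed.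

Let coprime_prime (q : nat) : prime q -> p <> q -> coprime p q.
Proof. by move=> q_pr /eqP pq; rewrite prime_coprime // dvdn_prime2. Qed.

Let cop2 : coprime p 2. Proof. by rewrite coprimen2. Qed.
Let cop3 : coprime p 3. Proof. exact: coprime_prime. Qed.
Let cop7 : coprime p 7. Proof. exact: coprime_prime. Qed.
Let cop6 : coprime p 6. Proof. by rewrite -[6%N]/(2 * 3)%N coprimeMr cop2. Qed.
Let cop9 : coprime p 9. Proof. by rewrite -[9%N]/(3 * 3)%N coprimeMr cop3. Qed.
Let cop14 : coprime p 14. Proof. by rewrite -[14%N]/(2 * 7)%N coprimeMr cop2. Qed.
Let cop18 : coprime p 18. Proof. by rewrite -[18%N]/(2 * 9)%N coprimeMr cop2. Qed.
Let pq3 : p_integral p q3.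
Proof. exact: (@p_integral_fermat_quotient p 3). Qed.
Let pq7 : p_integral p q7.
Proof. exact: (@p_integral_fermat_quotient p 7). Qed.

Let pP : p_integral p P. Proof. exact: p_integral_nat. Qed.

Let p_half : p = (p./2).*2.+1. Proof. by rewrite -{1}(odd_double_half p) p_odd. Qed.

Lemma norm_congruence : Y ^+ 2 - 4 * Y * X + 7 * X ^+ 2 = 7 * (1 + P * q7).
Proof.
rewrite -(@fermat_quotientE p 7) // -[RHS]rmorphXn /= -(lucas_norm u0 u1 uS p).
by rewrite /X /Y; ring.
Qed.

Lemma sqr_power_minus3 : e ^+ 2 = 1 + P * q3.
Proof.
apply: (@mulfI _ (3 : rat)) => //; rewrite -(@fermat_quotientE p 3) //.
have -> : 3%:~R ^+ p = 3 * (3 ^+ 2) ^+ p./2 :> rat.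
  by rewrite -exprM -exprS mul2n -p_half.
by rewrite /e rmorphXn /= rmorphN (exprAC _ p./2 2) /= sqrrN rmorph_nat.
Qed.

(** The constants 2 and -4 are -1 + 3 and -1 - 3, because 3^p is replaced by
3 (1 + p q_p(3)). *)
Lemma residue_congruences :
  let E s t := ~~ (6 %| p + s)%N -> exists2 w, p_integral p w &
    t = 6 * ((6 %| s)%N%:R - P * power_sum p s + P ^+ 2 * w) in
  [/\ E 0%N (2 + 3 * P * q3 + 2 * Y - 4 * X),
      E 1%N (- 4 - 3 * P * q3 + 3 * e + 5 * X - Y),
      E 2%N (2 + 3 * P * q3 + 3 * e - X - Y),
      E 4%N (2 + 3 * P * q3 - 3 * e + 5 * X - Y) &
      E 5%N (- 4 - 3 * P * q3 - 3 * e - X - Y)].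
Proof.
have := residue_sum_lucas u0 u1 uS p./2.
rewrite /= -p_half => -[S0 S1 S2 S4 S5].
have T3 : (3 ^+ p : int)%:~R = 3 * (1 + P * q3).
  by rewrite rmorphXn; exact: (@fermat_quotientE p 3).
have expand s (t : int) (x : rat) : 6 * residue_sum p s = t -> t%:~R = x ->
    ~~ (6 %| p + s)%N -> exists2 w, p_integral p w &
    x = 6 * ((6 %| s)%N%:R - P * power_sum p s + P ^+ 2 * w).
  move=> rt <- /(residue_sum_expansion p_pr)[w pw rE]; exists w => //.
  by rewrite -rE -rt rmorphM.
move: (3 ^+ p : int) T3 S0 S1 S2 S4 S5 => t T3 S0 S1 S2 S4 S5.
rewrite -/e; split; [apply: expand S0 _|apply: expand S1 _|apply: expand S2 _
  |apply: expand S4 _|apply: expand S5 _];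
  rewrite !(rmorphD, rmorphN, rmorphM) /= T3 -/X -/Y -/e; ring.
Qed.

Lemma lucas_quotient_mod6_1 : (p %% 6 = 1)%N ->
  eqmodq p ((u p.-1)%:~R / P) (power_sum p 0 + 1 / 3 * q7 + 1 / 2 * q3) /\
  eqmodq p ((u p.-1)%:~R / P)
    (- (2 / 3) * power_sum p 1 - 1 / 18 * q7 + 1 / 6 * q3).
Proof.
move=> p1; have [E0 E1 _ E4 _] := residue_congruences.
have [|w0 pw0 {}E0] := E0; first by lia.
have [|w1 pw1 {}E1] := E1; first by lia.
have [|w4 pw4 {}E4] := E4; first by lia.
have pL s := @p_integral_power_sum p s p_pr.
have pL0 := pL 0%N; have pL1 := pL 1%N; have pL4 := pL 4%N.
have YE : Y = 4 * X - 7 * (u p.-1)%:~R.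
  have := lucas_rec uS p.-1; rewrite prednK ?prime_gt0 // /X /Y => ->.
  by ring.
have norm_XY := norm_congruence; rewrite YE in E0 E1 E4 norm_XY.
have [UE cB cC] := eliminate_mod6_1 P0 E0 E1 E4 norm_XY sqr_power_minus3.
rewrite UE [P * _]mulrC (mulfK P0).
by split; [apply: eqmodq_intro cB|apply: eqmodq_intro cC]; p_integral_tac.
Qed.

Lemma lucas_quotient_mod6_5 : (p %% 6 = 5)%N ->
  eqmodq p (Y / P) (- 7 * power_sum p 0 - 7 / 3 * q7 - 7 / 2 * q3) /\
  eqmodq p (Y / P) (14 / 3 * power_sum p 2 + 7 / 18 * q7 + 7 / 6 * q3).
Proof.
move=> p5; have [E0 _ E2 _ E5] := residue_congruences.
have [|w0 pw0 {}E0] := E0; first by lia.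
have [|w2 pw2 {}E2] := E2; first by lia.
have [|w5 pw5 {}E5] := E5; first by lia.
have pL s := @p_integral_power_sum p s p_pr.
have pL0 := pL 0%N; have pL2 := pL 2%N; have pL5 := pL 5%N.
have [YE cB cC] := eliminate_mod6_5 P0 E0 E2 E5 norm_congruence sqr_power_minus3.
rewrite YE [P * _]mulrC (mulfK P0).
by split; [apply: eqmodq_intro cB|apply: eqmodq_intro cC]; p_integral_tac.
Qed.

End Congruences.

(** * The congruences for the Lucas quotient *)

Theorem theorem3p6 (p : nat) (u : nat -> int)
    (p_prime : prime p) (p_odd : odd p) (p_neq3 : p <> 3%N) (p_neq7 : p <> 7%N)
    (u0 : u 0%N = 0) (u1 : u 1%N = 1)
    (uS : forall n : nat, (1 <= n)%N ->
            u (n + 1)%N = 4 * u n - 7 * u (n - 1)%N) :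
  ((p = 1 %[mod 3])%N ->
     eqmodq p ((u (p - 1)%N)%:~R / p%:R)
       (1 / 6 * (\sum_(1 <= k < ((p - 1) %/ 6).+1) 64 ^+ k / k%:R)
        + 1 / 3 * fermat_quotient p 7 + 1 / 2 * fermat_quotient p 3)
     /\
     eqmodq p
       (1 / 6 * (\sum_(1 <= k < ((p - 1) %/ 6).+1) 64 ^+ k / k%:R)
        + 1 / 3 * fermat_quotient p 7 + 1 / 2 * fermat_quotient p 3)
       (- (1 / 3) * (\sum_(1 <= k < ((p - 1) %/ 6).+1)
                       64 ^+ k / (6 * k%:R - 1))
        - 1 / 18 * fermat_quotient p 7 + 1 / 6 * fermat_quotient p 3))
  /\
  ((p = 2 %[mod 3])%N ->
     eqmodq p ((u (p + 1)%N)%:~R / p%:R)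
       (- (7 / 6) * (\sum_(1 <= k < ((p - 5) %/ 6).+1) 64 ^+ k / k%:R)
        - 7 / 3 * fermat_quotient p 7 - 7 / 2 * fermat_quotient p 3)
     /\
     eqmodq p
       (- (7 / 6) * (\sum_(1 <= k < ((p - 5) %/ 6).+1) 64 ^+ k / k%:R)
        - 7 / 3 * fermat_quotient p 7 - 7 / 2 * fermat_quotient p 3)
       (7 / 6 * (\sum_(1 <= k < ((p + 1) %/ 6).+1)
                   64 ^+ k / (6 * k%:R - 2))
        + 7 / 18 * fermat_quotient p 7 + 7 / 6 * fermat_quotient p 3)).
Proof.
(* It is enough to compare the Lucas quotient with both expressions. *)
have q_split (x : rat) B C : eqmodq p x B /\ eqmodq p x C ->
    eqmodq p x B /\ eqmodq p B C.
  by case=> xB xC; split=> //; apply: eqmodq_trans xC; apply: eqmodq_sym.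
have p_gt1 := prime_gt1 p_prime.
split=> p_mod3; apply: q_split; rewrite ?subn1 ?addn1.
- have p_mod6 : (p %% 6 = 1)%N by lia.
  have pE : p = (6 * (p.-1 %/ 6)).+1 by lia.
  have [] := lucas_quotient_mod6_1 p_prime p_odd p_neq3 p_neq7 u0 u1 uS p_mod6.
  set m := (p.-1 %/ 6)%N in pE *.
  have -> : \sum_(1 <= k < m.+1) 64 ^+ k / (6 * k%:R - 1) = 2 * power_sum p 1.
    by apply: (@power_sumE p m 1) => //; lia.
  rewrite (@sum_inverses_multiples6 p m); last by lia.
  have -> : - (1 / 3) * (2 * power_sum p 1) = - (2 / 3) * power_sum p 1 by field.
  by have -> : 1 / 6 * (6 * power_sum p 0) = power_sum p 0 by field.
- have p_mod6 : (p %% 6 = 5)%N by lia.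
  set m := ((p - 5) %/ 6)%N.
  have pE : p = (6 * m + 5)%N by lia.
  have -> : (p.+1 %/ 6 = m.+1)%N by lia.
  have [] := lucas_quotient_mod6_5 p_prime p_odd p_neq3 p_neq7 u0 u1 uS p_mod6.
  have -> : \sum_(1 <= k < m.+2) 64 ^+ k / (6 * k%:R - 2) = 4 * power_sum p 2.
    have -> : 4 = 2 ^+ 2 :> rat by [].
    by apply: (@power_sumE p m.+1 2) => //; lia.
  rewrite (@sum_inverses_multiples6 p m); last by lia.
  have -> : 7 / 6 * (4 * power_sum p 2) = 14 / 3 * power_sum p 2 by field.
  by have -> : - (7 / 6) * (6 * power_sum p 0) = - 7 * power_sum p 0 by field.
Qed.
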